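(* Let $f:\mathbb{N}\to\mathbb{N}$ be a function such that for every $c\in\mathbb{N}$ and every $c$-coloring of $\{1,\ldots,f(c)\}$ there exist $x<y$ in $\{1,\ldots,f(c)\}$ such that $x$ and $y$ have the same color and $y-x$ is a perfect square. Then $f(c)\ge \Omega(c^{3.75})$; that is, there exist a constant $C>0$ and a $c_0$ such that $f(c)\ge C\,c^{3.75}$ for all $c\ge c_0$.
   Context: $\mathbb{N}=\{1,2,3,\ldots\}$. A $c$-coloring of $\{1,\ldots,N\}$ is a map $\{1,\ldots,N\}\to\{1,\ldots,c\}$. A perfect square is the square of an integer. Such a function $f$ is known to exist (by the polynomial van der Waerden theorem). *)

(* Defs.v *)
From mathcomp Require Import all_boot all_order all_algebra.
Set Implicit Arguments.
Unset Strict Implicit.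
Unset Printing Implicit Defensive.

Import GRing.Theory.

(* A map {1,...,N} -> {1,...,c}, encoded as a total function on nat whose
   values outside {1,...,N} are unconstrained. *)
Definition is_coloring (c N : nat) (chi : nat -> nat) : Prop :=
  forall i : nat, (1 <= i <= N)%N -> (1 <= chi i <= c)%N.

Definition perfect_square (z : int) : Prop :=
  exists k : int, z = (k ^+ 2)%R.

Definition has_mono_square_diff (N : nat) (chi : nat -> nat) : Prop :=
  exists x y : nat,
    [/\ (1 <= x)%N, (x < y)%N, (y <= N)%N,
        chi x = chi y & perfect_square (y%:Z - x%:Z)%R].

(* Main.v *)
(** Write numbers in base 205 = 5 * 41. Twelve residues mod 205 (Beigel and
    Gasarch, refining Ruzsa) have no nonzero square as a difference. If the
    base-205 digits of x and x + z^2 at all even positions below 2k lie, as a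
    vector mod 205, in a common translate of the k-th power of this set, then
    205^k divides z: digit by digit, the lowest digits give 205 | z^2, hence
    205 | z since 205 is squarefree, and one divides by 205^2. So a covering of
    (Z/205)^k by M translates is an M-coloring of [1, 205^(2k) - 1] without
    monochromatic square differences. Greedily, M = O(k (205/12)^k) translates
    suffice. Since 205^7 < 12^15, (205/12)^15 is smaller than 205^8, and the gap
    absorbs the factor k: M^(15/4) = O(205^(2k)). *)
Require Import Defs.
From HB Require Import structures.
From mathcomp Require Import all_boot all_order all_algebra.
From mathcomp Require Import reals exp.
From mathcomp Require Import zify ring lra.
Set Implicit Arguments.
Unset Strict Implicit.
Unset Printing Implicit Defensive.

Import Order.TTheory GRing.Theory Num.Theory.
Local Open Scope ring_scope.

(** Bernoulli's inequality; it makes every [q] greedy steps at least halve the bound on the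
    uncovered set. *)
Lemma double_pred_expn_le (q : nat) : (0 < q)%N -> (2 * q.-1 ^ q <= q ^ q)%N.
Proof.
case: q => // q _ /=.
have H n : (q ^ n.+1 + n.+1 * q ^ n <= q.+1 ^ n.+1)%N.
  elim: n => [|n IH]; first by rewrite !expn1 expn0 muln1 addn1.
  rewrite [(q.+1 ^ _)%N]expnS; apply: leq_trans (leq_mul (leqnn _) IH).
  by rewrite !(expnS q); nia.
by have := H q; rewrite !expnS; nia.
Qed.

(** * Covering a finite abelian group by translates *)

Section GreedyCover.
Variables (G : finZmodType) (A : {set G}) (q : nat).
Hypothesis cardG_le : (#|G| <= q * #|A|)%N.

Let uncovered (T : seq G) : {set G} := [set x | ~~ has (fun t => x - t \in A) T].

(** Double counting: t -> x - t is injective, so each x of [U] lies in exactly #|A| translates. *)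
Lemma sum_card_translate (U : {set G}) :
  (\sum_(t : G) #|[set x in U | (x - t)%R \in A]| = #|U| * #|A|)%N.
Proof.
under eq_bigr => t _ do rewrite -sum1_card.
under eq_bigr => t _ do under eq_bigl => x do rewrite inE.
rewrite (exchange_big_dep (mem U)) /=; last by move=> t x _ /andP[].
rewrite -sum_nat_const; apply: eq_bigr => x xU.
under eq_bigl => t do rewrite xU /=.
rewrite sum1dep_card -(card_imset _ (subrI x)); apply: eq_card => y.
apply/imsetP/idP => [[t]|yA]; first by rewrite inE => xtA ->.
by exists (x - y); rewrite ?inE opprB addrC subrK.
Qed.

Lemma translate_meets_average (U : {set G}) :
  exists t, (#|U| <= q * #|[set x in U | (x - t)%R \in A]|)%N.
Proof.
apply/existsP; apply: contraT; rewrite negb_exists => /forallP H.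
have A_gt0 : (0 < #|A|)%N.
  rewrite lt0n; apply/eqP => A0; move: cardG_le.
  by rewrite A0 muln0 leqn0 => /eqP/card0_eq/(_ 0); rewrite inE.
have G_gt0 : (0 < #|G|)%N by apply/card_gt0P; exists 0.
(* If every t failed, summing would give q #|U| #|A| + #|G| <= #|G| #|U| <= q #|A| #|U|, impossible
   as [G] is nonempty. *)
have : (\sum_(t : G) (q * #|[set x in U | (x - t)%R \in A]|).+1 <= #|G| * #|U|)%N.
  by rewrite -sum_nat_const; apply: leq_sum => t _; rewrite ltnNge.
under eq_bigr => t _ do rewrite -addn1.
rewrite big_split /= -big_distrr /= sum_card_translate sum1_card -[#|xpredT|]/#|G|.
move=> /leq_trans/(_ (leq_mul cardG_le (leqnn #|U|))).
by rewrite (mulnC #|U|) mulnA -[leqRHS]addn0 leq_add2l leqNgt G_gt0.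
Qed.

Lemma greedy_cover_step (n : nat) :
  exists2 T : seq G, size T = n &
    (#|uncovered T| * q ^ n <= #|G| * q.-1 ^ n)%N.
Proof.
elim: n => [|n [T sT IH]].
  by exists [::]; rewrite // !expn0 !muln1 max_card.
have [t Ht] := translate_meets_average (uncovered T).
exists (t :: T); first by rewrite /= sT.
have E : uncovered (t :: T) =
   uncovered T :\: [set x in uncovered T | x - t \in A].
  apply/setP => x; rewrite !inE /=.
  by case: (x - t \in A) => //=; case: has.
have Hsub : [set x in uncovered T | x - t \in A] \subset uncovered T.
  by apply/subsetP => x; rewrite inE => /andP[].
have := cardsID [set x in uncovered T | x - t \in A] (uncovered T).
rewrite -E (setIidPr Hsub) => Hc.
have H : (q * #|uncovered (t :: T)| <= q.-1 * #|uncovered T|)%N by nia.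
rewrite !expnS; have := leq_mul H (leqnn (q ^ n)).
by have := leq_mul (leqnn q.-1) IH; nia.
Qed.

(** After q s steps at most #|G| / 2^s < 1 elements remain uncovered. *)
Lemma greedy_cover (s : nat) : (#|G| < 2 ^ s)%N ->
  exists2 T : seq G, size T = (q * s)%N & forall x, has (fun t => x - t \in A) T.
Proof.
move=> Gs; have q_gt0 : (0 < q)%N.
  have G_gt0 : (0 < #|G|)%N by apply/card_gt0P; exists 0.
  by have := leq_trans G_gt0 cardG_le; case: q.
have [T sT HT] := greedy_cover_step (q * s); exists T => // x.
suff U0 : #|uncovered T| = 0%N.
  by have := card0_eq U0 x; rewrite inE => /negbFE.
have Hs : (2 ^ s * q.-1 ^ (q * s) <= q ^ (q * s))%N.
  rewrite !expnM -expnMn; case: s {Gs sT HT} => // s.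
  by rewrite leq_exp2r // double_pred_expn_le.
have P : (0 < q ^ (q * s))%N by rewrite expn_gt0 q_gt0.
have : (#|uncovered T| * 2 ^ s <= #|G|)%N.
  rewrite -(leq_pmul2r P); nia.
nia.
Qed.

End GreedyCover.

(** * Residues mod 205 without nonzero square differences *)

Definition beigel_gasarch : seq nat :=
  [:: 0; 2; 8; 14; 77; 79; 85; 96; 103; 109; 111; 181]%N.

Definition beigel_gasarch_set : {set 'Z_205} :=
  [set x : 'Z_205 | val x \in beigel_gasarch].

Lemma card_beigel_gasarch_set : #|beigel_gasarch_set| = 12.
Proof.
have -> : 12 = size (map (@inZp (Zp_trunc 205).+1) beigel_gasarch) by [].
rewrite -(card_uniqP _); last by vm_compute.
apply: eq_card => x; rewrite inE; apply/idP/mapP => [xB|[n nB ->]].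
  by exists (val x) => //; rewrite valZpK.
by rewrite /= modn_small //; move: n nB; apply/allP; vm_compute.
Qed.

Definition sqr_mod205 : seq nat := [seq z * z %% 205 | z <- iota 0 205]%N.

(** Finite check on [nat]; the formula is subtraction in 'Z_205 unfolded, so it transfers there by
    conversion. *)
Lemma beigel_gasarch_sub_sqr (r r' : nat) :
  r \in beigel_gasarch -> r' \in beigel_gasarch ->
  ((r' + (205 - r) %% 205) %% 205 \in sqr_mod205 ->
   (r' + (205 - r) %% 205) %% 205 = 0)%N.
Proof.
have : let sqs := sqr_mod205 in all (fun r => all (fun r' =>
   let d := ((r' + (205 - r) %% 205) %% 205)%N in (d \in sqs) ==> (d == 0%N))
   beigel_gasarch) beigel_gasarch by vm_compute.
by move=> /allP h /h/allP h' /h'/implyP h'' /h''/eqP.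
Qed.

Lemma beigel_gasarch_set_sub_sqr (a b w : 'Z_205) :
  a \in beigel_gasarch_set -> b \in beigel_gasarch_set ->
  b - a = w ^+ 2 -> w ^+ 2 = 0.
Proof.
rewrite !in_set => aB bB E; have := beigel_gasarch_sub_sqr aB bB.
have -> : ((val b + (205 - val a) %% 205) %% 205)%N = val (b - a) by [].
rewrite E => sqr0; apply: val_inj; apply: sqr0.
rewrite expr2; apply/mapP; exists (val w) => //.
by rewrite mem_iota /= (ltn_ord w).
Qed.

(** * Digit vectors and the coloring *)

HB.instance Definition _ (aT : finType) (rT : finZmodType) :=
  Finite.on {ffun aT -> rT}.

(* The cast to 'Z_205 keeps only the digit at position 2 i. *)
Definition even_digits (k n : nat) : {ffun 'I_k -> 'Z_205} :=
  [ffun i : 'I_k => (n %/ 205 ^ (2 * i))%:R].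

Lemma sqr_diff_dvdn (k x y z : nat) (t : {ffun 'I_k -> 'Z_205}) :
  y = (x + z ^ 2)%N ->
  (forall i, even_digits k x i - t i \in beigel_gasarch_set) ->
  (forall i, even_digits k y i - t i \in beigel_gasarch_set) ->
  (205 ^ k %| z)%N.
Proof.
elim: k x y z t => [|k IH] x y z t Ey Hx Hy; first by rewrite dvd1n.
have z2 : (z%:R : 'Z_205) ^+ 2 = 0.
  apply: (beigel_gasarch_set_sub_sqr (Hx ord0) (Hy ord0)).
  by rewrite !ffunE !muln0 expn0 !divn1 Ey natrD natrX; ring.
have : (205 %| z ^ 2)%N.
  by move/eqP: z2; rewrite -natrX -val_eqE /= val_Zp_nat.
have -> : (205 = 5 * 41)%N by [].
rewrite Gauss_dvd // !Euclid_dvdX // !andbT -Gauss_dvd // => /dvdnP[w Ew].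
rewrite expnS Ew mulnC dvdn_pmul2r //.
(* Since z^2 = 205^2 w^2, dividing by 205^2 keeps the difference a square and shifts the even digits
   by one. *)
apply: (IH (x %/ 205 ^ 2) (y %/ 205 ^ 2) w [ffun i => t (lift ord0 i)])%N.
- by rewrite Ey Ew expnMn addnC divnMDl // addnC.
- move=> i; have := Hx (lift ord0 i); rewrite !ffunE.
  by rewrite -divnMA -expnD /= /bump /= mulnDr.
- move=> i; have := Hy (lift ord0 i); rewrite !ffunE.
  by rewrite -divnMA -expnD /= /bump /= mulnDr.
Qed.

Lemma square_diff_free_coloring (k : nat) :
  exists chi : nat -> nat,
    (forall n, 1 <= chi n <= (205 ^ k %/ 12 ^ k).+1 * (8 * k).+1)%N /\
    forall x y z : nat, y = (x + z ^ 2)%N -> chi x = chi y -> (205 ^ k %| z)%N.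
Proof.
pose A := [set v : {ffun 'I_k -> 'Z_205} | v \in ffun_on (mem beigel_gasarch_set)].
have cardA : #|A| = (12 ^ k)%N.
  by rewrite cardsE card_ffun_on card_beigel_gasarch_set card_ord.
have cardG : #|{ffun 'I_k -> 'Z_205}| = (205 ^ k)%N.
  by rewrite card_ffun !card_ord.
have Gq : (#|{ffun 'I_k -> 'Z_205}| <= (205 ^ k %/ 12 ^ k).+1 * #|A|)%N.
  by rewrite cardG cardA ltnW // ltn_ceil // expn_gt0.
have Gs : (#|{ffun 'I_k -> 'Z_205}| < 2 ^ (8 * k).+1)%N.
  rewrite cardG expnS mul2n -addnn expnM.
  have : (205 ^ k <= (2 ^ 8) ^ k)%N by case: (k) => // n; rewrite leq_exp2r.
  have : (0 < (2 ^ 8) ^ k)%N by rewrite expn_gt0.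
  by lia.
have [T sT HT] := greedy_cover Gq Gs.
pose p n := fun t => even_digits k n - t \in A.
(* The color is the index of the first translate covering the digit vector. *)
exists (fun n => (find (p n) T).+1); split => [n|x y z Ey [fxy]].
  by rewrite /= -sT -has_find HT.
pose t := nth 0 T (find (p x) T).
have tx : p x t by apply: nth_find; apply: HT.
have ty : p y t by rewrite /t fxy; apply: nth_find; apply: HT.
apply: (sqr_diff_dvdn (t := t) Ey) => i.
  by move: tx; rewrite /p inE => /ffun_onP/(_ i); rewrite !ffunE.
by move: ty; rewrite /p inE => /ffun_onP/(_ i); rewrite !ffunE.
Qed.

Lemma expn_le_of_square_diff_coloring (f : nat -> nat) (k c : nat) :
  (forall chi : nat -> nat, is_coloring c (f c) chi ->
     has_mono_square_diff (f c) chi) ->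
  ((205 ^ k %/ 12 ^ k).+1 * (8 * k).+1 <= c)%N -> (205 ^ (2 * k) <= f c)%N.
Proof.
move=> f_sq Hc; have [chi [chi_le chi_sq]] := square_diff_free_coloring k.
have [i _|x [y [x_gt0 xy y_le chixy [z Ez]]]] := f_sq chi.
  by have /andP[-> /leq_trans->] := chi_le i.
have Ey : y = (x + `|z| ^ 2)%N.
  by rewrite -abszX -Ez; lia.
have z_gt0 : (0 < `|z|)%N by lia.
have := dvdn_leq z_gt0 (chi_sq x y _ Ey chixy).
(* z is nonzero, so 205^(2k) <= z^2 < y <= [f c]. *)
rewrite mulnC expnM ; move: (205 ^ k)%N => N; nia.
Qed.

(** * Growth estimate *)

Lemma powR_le_of_lt_colors (R : realType) (c k N : nat) :
  (c < (205 ^ k.+1 %/ 12 ^ k.+1).+1 * (8 * k.+1).+1)%N ->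
  (205 ^ (2 * k) <= N)%N ->
  (c%:R : R) `^ (15%:R / 4%:R) <= (2%:R ^+ 20) `^ (15%:R / 4%:R) * N%:R.
Proof.
move=> c_lt N_ge.
(* The powers of [r] absorb the linear factor in k. *)
pose s : R := 205%:R / 12%:R; pose r : R := 2001%:R / 2000%:R.
have s_gt0 : 0 < s by rewrite /s; lra.
have r_gt0 : 0 < r by rewrite /r; lra.
have s_ge1 : 1 <= s by rewrite /s; lra.
have quot_le : ((205 ^ k.+1 %/ 12 ^ k.+1).+1)%:R <= 2%:R * s ^+ k.+1.
  have : (205 ^ k.+1 %/ 12 ^ k.+1)%:R <= s ^+ k.+1.
    rewrite expr_div_n ler_pdivlMr ?exprn_gt0 ?ltr0n // -!natrX -natrM ler_nat.
    exact: leq_trunc_div.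
  have : 1 <= s ^+ k.+1 by rewrite exprn_ege1.
  rewrite -natr1; lra.
have bernoulli : k.+1%:R <= 2000%:R * r ^+ k.
  elim: k {c_lt N_ge quot_le} => [|k IH]; first by rewrite expr0; lra.
  have r1 : 1 <= r ^+ k by rewrite exprn_ege1 // /r; lra.
  rewrite -natr1 exprS {1}/r; lra.
(* The constants multiply to 2 * (205/12) * 9 * 2000 = 615000 < 2^20. *)
have c_le : c%:R <= 2%:R ^+ 20 * (s * r) ^+ k.
  have c1 : (c%:R : R) <= 2%:R * s ^+ k.+1 * (9%:R * k.+1%:R).
    apply: le_trans (_ : ((205 ^ k.+1 %/ 12 ^ k.+1).+1 * (8 * k.+1).+1)%:R <= _).
      by rewrite ler_nat ltnW.
    rewrite natrM; apply: ler_pM; [exact: ler0n..|exact: quot_le|].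
    by rewrite -natrM ler_nat; clear; lia.
  apply: le_trans c1 _.
  have a_ge0 : 0 <= s ^+ k by rewrite exprn_ge0 // ltW.
  have b_ge0 : 0 <= r ^+ k by rewrite exprn_ge0 // ltW.
  have := ler_wpM2l a_ge0 bernoulli; have := mulr_ge0 a_ge0 b_ge0.
  rewrite (exprMn k s r) exprS.
  by move: (s ^+ k) (r ^+ k) (k.+1%:R : R) => a b n; rewrite /s; lra.
have sr_le : (s * r) ^+ 15 <= 205%:R ^+ 8.
  (* This is where 205^7 < 12^15 is used; 2001/2000 fits in the gap. *)
  rewrite /s /r; lra.
have sr0 : 0 <= s * r by rewrite mulr_ge0 // ltW.
apply: le_trans (_ : (2%:R ^+ 20 * (s * r) ^+ k) `^ (15%:R / 4%:R) <= _).
  apply: ge0_ler_powR; rewrite ?nnegrE ?ler0n ?mulr_ge0 ?exprn_ge0 //; lra.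
rewrite powRM ?ler0n ?exprn_ge0 // ler_wpM2l ?powR_ge0 //.
apply: le_trans (_ : (205 ^ (2 * k))%:R <= _); last by rewrite ler_nat.
(* The exponent 15/4 is split into a 15th power, bounded by [sr_le], and a fourth root. *)
rewrite powRrM powR_mulrn ?exprn_ge0 // -exprM mulnC exprM.
apply: le_trans (_ : ((205%:R ^+ 8) ^+ k) `^ (4%:R^-1) <= _).
  apply: ge0_ler_powR; rewrite ?nnegrE ?exprn_ge0 ?lerXn2r ?nnegrE ?exprn_ge0 //; lra.
have -> : (205%:R ^+ 8) ^+ k = ((205 ^ (2 * k))%:R : R) ^+ 4.
  by rewrite natrX -!exprM; congr (_ ^+ _); clear; lia.
by rewrite -powR_mulrn ?ler0n // -powRrM mulfV ?pnatr_eq0 // powRr1 ?ler0n.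
Qed.

Theorem theorem4p5 (R : realType) (f : nat -> nat)
    (f_pos : forall c : nat, (1 <= c)%N -> (1 <= f c)%N)
    (f_sq : forall c : nat, (1 <= c)%N ->
       forall chi : nat -> nat, is_coloring c (f c) chi ->
         has_mono_square_diff (f c) chi) :
  exists (C : R) (c0 : nat), 0 < C /\
    forall c : nat, (1 <= c)%N -> (c0 <= c)%N ->
      C * (c%:R `^ (15%:R / 4%:R)) <= (f c)%:R.
Proof.
have B_gt0 : 0 < ((2%:R : R) ^+ 20) `^ (15%:R / 4%:R) by rewrite powR_gt0 // exprn_gt0.
(* The threshold 2 is the color count at k = 0, so some k is always admissible. *)
exists (((2%:R ^+ 20) `^ (15%:R / 4%:R))^-1), 2; split; first by rewrite invr_gt0.
move=> c c_ge1 c_ge2; rewrite ler_pdivrMl //.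
pose M k := ((205 ^ k %/ 12 ^ k).+1 * (8 * k).+1)%N.
have ex0 : exists k, (M k <= c)%N by exists 0%N.
have bound k : (M k <= c)%N -> (k <= c)%N.
  by move/(leq_trans (leq_pmull _ (ltn0Sn _))); clear; lia.
(* For the largest k with M k <= c, c lies below M (k+1). *)
have [k Mk maxk] := ex_maxnP ex0 bound.
apply: (@powR_le_of_lt_colors _ c k);
  last exact: expn_le_of_square_diff_coloring (f_sq c c_ge1) Mk.
by rewrite ltnNge; apply/negP => /maxk; rewrite ltnn.
Qed.
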